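(* Let $X$ be a second countable Baire complex topological vector space and $\Gamma$ a subset of $\mathcal{B}(X)$. Then the following assertions are equivalent: (i) $HC(\Gamma)$ is dense in $X$; (ii) $\Gamma$ is topologically transitive. As a consequence, if $\Gamma$ is topologically transitive, then $\Gamma$ is hypercyclic.
   Context: $\mathcal{B}(X)$ denotes the set of all continuous linear operators on $X$. For $\Gamma\subset\mathcal{B}(X)$ and $x\in X$, $Orb(\Gamma,x)=\{Tx : T\in\Gamma\}$. A vector $x$ is a hypercyclic vector for $\Gamma$ if $Orb(\Gamma,x)$ is dense in $X$; $HC(\Gamma)$ is the set of all hypercyclic vectors for $\Gamma$; $\Gamma$ is hypercyclic if $HC(\Gamma)\neq\emptyset$. $\Gamma$ is topologically transitive if for each pair $(U,V)$ of nonempty open subsets of $X$ there exists $T\in\Gamma$ such that $T(U)\cap V\neq\emptyset$. *)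

(* Defs.v *)
From HB Require Import structures.
From mathcomp Require Import all_boot all_order all_algebra.
From mathcomp Require Export complex.
From mathcomp Require Import all_classical all_reals all_analysis.

Set Implicit Arguments.
Unset Strict Implicit.
Unset Printing Implicit Defensive.

Import GRing.Theory Num.Theory.
Import numFieldNormedType.Exports.
Local Open Scope classical_set_scope.
Local Open Scope ring_scope.

Definition baire_space (T : topologicalType) : Prop :=
  forall F : (set T)^nat,
    (forall n, open (F n) /\ dense (F n)) -> dense (\bigcap_n F n).

Section Hypercyclicity.
(* [topologicalLmodType] is a topological vector space without local convexity,
   in contrast with [tvsType]; it is not assumed to be Hausdorff. *)
Variables (K : numFieldType) (X : topologicalLmodType K).

Definition continuous_operators : set {linear X -> X} :=
  [set T : {linear X -> X} | continuous T].

Implicit Type Gamma : set {linear X -> X}.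

Definition Orb Gamma (x : X) : set X :=
  [set (T : {linear X -> X}) x | T in Gamma].

Definition HC Gamma : set X := [set x | dense (Orb Gamma x)].

Definition hypercyclic Gamma : Prop := HC Gamma !=set0.

Definition topologically_transitive Gamma : Prop :=
  forall U V : set X, open U -> U !=set0 -> open V -> V !=set0 ->
  exists2 T : {linear X -> X}, Gamma T & (T @` U) `&` V !=set0.

End Hypercyclicity.

Arguments continuous_operators {K} X.

(* Main.v *)
Require Import Defs.
From mathcomp Require Import all_boot all_order all_algebra.
From mathcomp Require Import all_classical all_reals all_analysis.

(** This is the Birkhoff transitivity argument.

    If a dense set of points has dense orbit, then any nonempty open [U]
    contains such a point, and its orbit meets any nonempty open [V]: hence
    [Gamma] is transitive.

    Conversely, a point has dense orbit if and only if its orbit meets every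
    nonempty member of a basis ([HC_basisE]), that is, if and only if it lies
    in every hitting set [{x | T x \in V for some T \in Gamma}] with [V] a
    nonempty basic open set.  Such a set is a union of preimages of [V], hence
    open by continuity ([open_hitting]), and transitivity says exactly that it
    is dense ([dense_hitting]).  With a countable basis, [HC Gamma] is thus a
    countable intersection of dense open sets, and is dense by the Baire
    property ([baire_space_countable]).

    Hypercyclicity follows because a dense subset of a nonempty space is
    nonempty, and [X] contains 0. *)

Local Open Scope classical_set_scope.
Local Open Scope ring_scope.

(** Countable families reduce to sequences by grouping the indices according to
    an injective numbering: each group has at most one element, so that the
    intersection over it is either a member of the family or the whole space. *)
Lemma baire_space_countable (T : topologicalType) (I : Type) (D : set I)
    (F : I -> set T) :
  baire_space T -> countable D ->
  (forall i, D i -> open (F i) /\ dense (F i)) -> dense (\bigcap_(i in D) F i).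
Proof.
move=> baireT /countable_injP[f f_inj] F_open_dense.
pose G n := \bigcap_(i in D `&` f @^-1` [set n]) F i.
have -> : \bigcap_(i in D) F i = \bigcap_n G n.
  apply/seteqP; split=> [x Fx n _ i [Di _]|x Gx i Di]; first exact: Fx.
  by apply: (Gx (f i)).
apply: baireT => n.
have [[i [Di fi]]|no_index] := pselect (exists i, D i /\ f i = n).
  suff -> : G n = F i by exact: F_open_dense.
  rewrite /G; suff -> : D `&` f @^-1` [set n] = [set i] by rewrite bigcap_set1.
  apply/seteqP; split=> [j [Dj fj]|j ->//].
  by apply: f_inj; rewrite ?inE// fi.
suff -> : G n = setT.
  by split; [exact: openT | move=> O O0 _; rewrite setIT].
by apply/seteqP; split=> // x _ i [Di fi]; case: no_index; exists i.
Qed.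

(** A nonempty open set contains a nonempty basic one, so it is enough to test
    density on the latter. *)
Lemma dense_basis (T : topologicalType) (B : set (set T)) (S : set T) :
  basis B ->
  dense S <-> (forall V, B V -> V !=set0 -> V `&` S !=set0).
Proof.
move=> [B_open B_nbhs]; split=> [S_dense V BV V0|S_meets O [x Ox] O_open].
  by apply: S_dense => //; exact: B_open.
have [V [BV Vx] VO] := B_nbhs x O (open_nbhs_nbhs (conj O_open Ox)).
have [y [Vy Sy]] := S_meets V BV (ex_intro _ x Vx).
by exists y; split=> //; exact: VO.
Qed.

Section Transitivity.
Variables (K : numFieldType) (X : topologicalLmodType K).
Implicit Types (Gamma : set {linear X -> X}) (V : set X).

Definition hitting Gamma V : set X :=
  \bigcup_(T in Gamma) ((T : {linear X -> X}) @^-1` V).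

Lemma open_hitting Gamma V :
  Gamma `<=` continuous_operators X -> open V -> open (hitting Gamma V).
Proof.
move=> Gamma_cont V_open; apply: bigcup_open => T GT.
by move/continuousP: (Gamma_cont T GT); exact.
Qed.

Lemma dense_hitting Gamma V : topologically_transitive Gamma ->
  open V -> V !=set0 -> dense (hitting Gamma V).
Proof.
move=> Gamma_trans V_open V0 U U0 U_open.
have [T GT [_ [[x Ux <-] VTx]]] := Gamma_trans U V U_open U0 V_open V0.
by exists x; split=> //; exists T.
Qed.

Lemma HC_basisE Gamma (B : set (set X)) : basis B ->
  HC Gamma = \bigcap_(V in [set V | B V /\ V !=set0]) hitting Gamma V.
Proof.
move=> B_basis; apply/seteqP; split=> x.
  move=> /(dense_basis _ _ _ B_basis) x_hits V [BV V0].
  by have [y [Vy [T GT Tx_y]]] := x_hits V BV V0; exists T; rewrite //= Tx_y.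
move=> x_hits; apply/(dense_basis _ _ _ B_basis) => V BV V0.
have [T GT VTx] := x_hits V (conj BV V0).
by exists (T x); split=> //; exists T.
Qed.

Lemma transitive_of_dense_HC Gamma :
  dense (HC Gamma) -> topologically_transitive Gamma.
Proof.
move=> HC_dense U V U_open U0 V_open V0.
have [x [Ux x_hc]] := HC_dense U U0 U_open.
have [y [Vy [T GT Tx_y]]] := x_hc V V0 V_open.
by exists T => //; exists (T x); split; [exists x | rewrite Tx_y].
Qed.

Lemma dense_HC_of_transitive Gamma :
  @second_countable X -> baire_space X -> Gamma `<=` continuous_operators X ->
  topologically_transitive Gamma -> dense (HC Gamma).
Proof.
move=> [B B_countable B_basis] X_baire Gamma_cont Gamma_trans.
rewrite (HC_basisE _ _ B_basis); apply: baire_space_countable => //.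
  by apply: sub_countable B_countable; apply: subset_card_le => V [].
move=> V [BV V0]; have V_open : open V by exact: B_basis.1.
by split; [exact: open_hitting | exact: dense_hitting].
Qed.

End Transitivity.

Theorem theorem3p6 (R : realType) (X : topologicalLmodType R[i])
    (X_second_countable : @second_countable X) (X_baire : baire_space X)
    (Gamma : set {linear X -> X})
    (Gamma_operators : Gamma `<=` continuous_operators X) :
  (dense (HC Gamma) <-> topologically_transitive Gamma) /\
  (topologically_transitive Gamma -> hypercyclic Gamma).
Proof.
have HC_dense := dense_HC_of_transitive _ _ _ X_second_countable X_baire
  Gamma_operators.
split; first by split=> //; exact: transitive_of_dense_HC.
move=> /HC_dense /(_ setT) [||x [_ x_hc]]; [by exists 0 | exact: openT |].
by exists x.
Qed.
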